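(* Let $m,\ell,\ell',t$ be positive integers with $m\ge t\ell+\ell'$, let $a>0$, and set $\varepsilon=\frac{2a+\sqrt{8\ln 2}}{\sqrt t}$. Let $\mathcal G\subset\binom{[m]}{\ell}$ and $\alpha:=|\mathcal G|/\binom{m}{\ell}$. Let $H$ be a uniformly random element of $\binom{[m]}{\ell'}$. Then $$\mathsf P\Big[\,|\mathcal G(\overline H)|<(\alpha-\varepsilon)\binom{m-\ell'}{\ell}\Big]<2e^{-a^2/2}.$$
   Context: $[m]=\{1,\dots,m\}$; $\binom{[m]}{\ell}$ is the family of all $\ell$-element subsets of $[m]$. For a family $\mathcal G$ and a set $H$, $\mathcal G(\overline H):=\{G\in\mathcal G: G\cap H=\varnothing\}$. $\ln$ is the natural logarithm. *)

(* Defs.v *)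
From HB Require Import structures.
From mathcomp Require Import all_boot all_order all_algebra.
From mathcomp Require Import all_classical all_reals all_analysis.
Set Implicit Arguments. Unset Strict Implicit. Unset Printing Implicit Defensive.
Import Order.TTheory GRing.Theory Num.Theory.
Local Open Scope ring_scope.

Definition avoid (m : nat) (G : {set {set 'I_m}}) (H : {set 'I_m}) : {set {set 'I_m}} :=
  [set G0 in G | [disjoint G0 & H]].

Definition unif_prob (R : realType) (m k : nat) (E : pred {set 'I_m}) : R :=
  (#|[set H : {set 'I_m} | (#|H| == k) && E H]|%:R) / ('C(m, k))%:R.

(* Main.v *)
Require Import Defs.
From HB Require Import structures.
From mathcomp Require Import all_boot all_order all_algebra.
From mathcomp Require Import all_classical all_reals all_analysis.
From mathcomp Require Import ring lra zify.
Import Order.TTheory GRing.Theory Num.Theory.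
Local Open Scope ring_scope.

(** For a set [U], let [density U] be the proportion of the [l]-subsets of [U]
    lying in [G]; the theorem is a lower tail bound for [density (~: H)].
    Remove the points of [H] one at a time: the density is then a martingale.
    With [k = #|U|], removing [x] changes it by
    [l / (k - l)] times the difference between [density U] and the density of [G]
    among the [l]-subsets of [U] through [x].  These steps are bounded by
    [l / (k - l)], but, because point degrees are the level-one part of a
    bounded function, their mean square is only [l / (4 (k - l) ^ 2)], a factor
    [l] better than the trivial bound.  A Bernstein-type exponential moment
    estimate therefore accumulates only [l * sum_k 1 / (k - l) ^ 2 = O(1 / t)],
    and Markov's inequality gives the tail [exp (- 3 (t - 1) eps ^ 2 / 8)]. *)

(** * An exponential inequality and restricted families *)

(** Combine [expR x <= 1 / (1 - x)] with [(1 - x) * (1 + x + 2 * x ^+ 2) = 1 + x ^+ 2 * (1 - 2 *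
    x)]. No lower bound on [x] enters, so one-sided control of the martingale steps suffices. *)
Lemma expR_le_quadratic (R : realType) (x : R) :
  x <= 1 / 2 -> expR x <= 1 + x + 2 * x ^+ 2.
Proof.
move=> hx; have x1 : 0 < 1 - x by lra.
rewrite -[x in expR x]opprK expRN.
apply: (@le_trans _ _ (1 - x)^-1).
  by rewrite lef_pV2 ?posrE ?expR_gt0// -[1 - x]/(1 + - x) expR_ge1Dx.
rewrite -[_^-1]mul1r ler_pdivrMr//.
have : 0 <= x ^+ 2 * (1 - 2 * x) by rewrite mulr_ge0 ?sqr_ge0//; lra.
by nra.
Qed.

(** Indexing by the surviving ground set [U] turns the removal of a point into an operation on [U];
    for [U = ~: H] this is [avoid G H]. *)
Definition inside {T : finType} (G : {set {set T}}) (U : {set T}) :=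
  [set B in G | B \subset U].

Definition layer (T : finType) (l : nat) := [set B : {set T} | #|B| == l].

(** * Counting and second moments on the [l]-subsets of [U] *)

Section SliceMoments.
Variables (R : realType) (T : finType).
Implicit Types (G : {set {set T}}) (U B : {set T}) (x y : T).

Lemma sum_inside_setD1 G U x (F : {set T} -> R) :
  \sum_(B in inside G (U :\ x)) F B =
  \sum_(B in inside G U) (1 - (x \in B)%:R) * F B.
Proof.
rewrite [LHS]big_mkcond [RHS]big_mkcond; apply: eq_bigr => B _.
rewrite !inE subsetD1; case: (B \in G) => //=; case: (B \subset U) => //=.
by case: (x \in B) => /=; rewrite ?subrr ?mul0r // subr0 mul1r.
Qed.

Lemma card_inside_setD1 G U x :
  #|inside G (U :\ x)|%:R =
  #|inside G U|%:R - \sum_(B in inside G U) (x \in B)%:R :> R.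
Proof.
rewrite -!sumr_const sum_inside_setD1 -sumrB.
by apply: eq_bigr => B _; rewrite mulr1.
Qed.

Lemma card_inside_layer U l : #|inside (layer T l) U| = 'C(#|U|, l).
Proof. by rewrite -cards_draws; apply: eq_card => B; rewrite !inE andbC. Qed.

(** Counting by complement gives a difference of binomials, valid for [l = 0] as well. *)
Lemma sum_mem_layer U l x : x \in U ->
  \sum_(B in inside (layer T l) U) (x \in B)%:R
  = 'C(#|U|, l)%:R - 'C(#|U|.-1, l)%:R :> R.
Proof.
move=> xU; have := card_inside_setD1 (layer T l) U x.
rewrite !card_inside_layer (cardsD1 x U) xU /= => ->; lra.
Qed.

Lemma sum_mem2_layer U l x y : x \in U -> y \in U -> y != x ->
  \sum_(B in inside (layer T l) U) (x \in B)%:R * (y \in B)%:R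
  = 'C(#|U|, l)%:R - 'C(#|U|.-1, l)%:R *+ 2 + 'C(#|U|.-2, l)%:R :> R.
Proof.
move=> xU yU yx.
have yUx : y \in U :\ x by rewrite !inE yx.
have cUx : #|U :\ x| = #|U|.-1 by rewrite (cardsD1 x U) xU.
have h := sum_mem_layer _ l _ yUx; rewrite sum_inside_setD1 cUx in h.
have hy := sum_mem_layer _ l _ yU.
transitivity (\sum_(B in inside (layer T l) U) ((y \in B)%:R : R)
  - \sum_(B in inside (layer T l) U) (1 - (x \in B)%:R) * (y \in B)%:R).
  by rewrite -sumrB; apply: eq_bigr => B _; ring.
by rewrite h hy; ring.
Qed.

Lemma sum_subset B U (d : T -> R) : B \subset U ->
  \sum_(x in B) d x = \sum_(x in U) (x \in B)%:R * d x.
Proof.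
move=> BU; rewrite [LHS]big_mkcond [RHS]big_mkcond; apply: eq_bigr => x _.
have := fintype.subsetP BU x.
by case: (x \in B) => [->//|_]; rewrite ?mul1r// mul0r; case: ifP.
Qed.

(** In the expanded square the coefficient of [d x * d y] depends only on whether [x = y]. As [d]
    sums to zero, the off-diagonal part of row [x] is a multiple of [- d x ^+ 2], leaving the
    diagonal coefficient minus the off-diagonal one. *)
Lemma sum_layer_sqr U l (d : T -> R) :
  \sum_(x in U) d x = 0 ->
  \sum_(B in inside (layer T l) U) (\sum_(x in B) d x) ^+ 2
  = ('C(#|U|.-1, l)%:R - 'C(#|U|.-2, l)%:R) * \sum_(x in U) d x ^+ 2.
Proof.
move=> d0.
transitivity (\sum_(B in inside (layer T l) U) \sum_(x in U) \sum_(y in U)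
   d x * (d y * ((x \in B)%:R * (y \in B)%:R))).
  apply: eq_bigr => B; rewrite inE => /andP[_ BU].
  rewrite (sum_subset _ _ _ BU) expr2 mulr_suml.
  apply: eq_bigr => x _; rewrite mulr_sumr; apply: eq_bigr => y _; ring.
rewrite exchange_big /= mulr_sumr; apply: eq_bigr => x xU.
rewrite exchange_big /=.
have d0x : \sum_(y in U :\ x) d y = - d x.
  by move: d0; rewrite (big_setD1 x)//= => /eqP; rewrite addrC addr_eq0 => /eqP.
rewrite (big_setD1 x)//=.
have -> : \sum_(B in inside (layer T l) U)
    d x * (d x * ((x \in B)%:R * (x \in B)%:R)) =
    d x ^+ 2 * ('C(#|U|, l)%:R - 'C(#|U|.-1, l)%:R).
  rewrite -(sum_mem_layer _ l _ xU) mulr_sumr; apply: eq_bigr => B _.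
  by case: (x \in B) => /=; ring.
under eq_bigr => y.
  rewrite !inE => /andP[yx yU]; rewrite -!mulr_sumr.
  rewrite (sum_mem2_layer _ l _ _ xU yU yx) mulrA (mulrC (d x)) -mulrA.
  over.
rewrite -mulr_suml d0x.
by move: ('C(#|U|, l)%:R : R) ('C(_, l)%:R : R) ('C(_, l)%:R : R) => *; ring.
Qed.

Lemma sum_layer0 U l (d : T -> R) :
  \sum_(x in U) d x = 0 ->
  \sum_(B in inside (layer T l) U) \sum_(x in B) d x = 0.
Proof.
move=> d0.
under eq_bigr => B.
  rewrite inE => /andP[_ BU]; rewrite (sum_subset _ _ _ BU); over.
rewrite exchange_big /=; under eq_bigr => x xU.
  rewrite -mulr_suml (sum_mem_layer _ l _ xU); over.
by rewrite -mulr_sumr d0 mulr0.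
Qed.

(** * Point degrees and their mean square *)

Definition degree G U x : R := \sum_(B in inside G U) (x \in B)%:R.

(** Deviation of the degree from its average [l * #|inside G U| / #|U|], scaled by [#|U|] to avoid
    division. *)
Definition degree_dev G U l x : R :=
  #|U|%:R * degree G U x - l%:R * #|inside G U|%:R.

Lemma sum_degree_mul G U (d : T -> R) :
  \sum_(x in U) degree G U x * d x =
  \sum_(B in inside G U) \sum_(x in B) d x.
Proof.
under eq_bigr do rewrite mulr_suml.
rewrite exchange_big /=; apply: eq_bigr => B; rewrite inE => /andP[_ BU].
by rewrite (sum_subset _ _ _ BU).
Qed.

Lemma sum_degree_dev G U l : {in G, forall B, #|B| = l} ->
  \sum_(x in U) degree_dev G U l x = 0.
Proof.
move=> hG; rewrite sumrB -mulr_sumr sumr_const.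
under eq_bigr do rewrite -[degree _ _ _]mulr1.
rewrite sum_degree_mul.
under eq_bigr => B.
  rewrite inE => /andP[/hG BG _]; rewrite sumr_const BG; over.
by rewrite sumr_const -[l%:R *+ _]mulr_natr -[X in _ - X]mulr_natr; ring.
Qed.

Lemma inside_sub_layer G U l : {in G, forall B, #|B| = l} ->
  inside G U \subset inside (layer T l) U.
Proof.
move=> hG; apply/fintype.subsetP => B; rewrite !inE => /andP[/hG-> ->].
by rewrite eqxx.
Qed.

(** At most ['C(k - 1, l - 1)] of the [l]-sets contain [x], where [k = #|U|], and
    [k * 'C(k - 1, l - 1) = l * 'C(k, l)]. *)
Lemma degree_dev_le G U l x : {in G, forall B, #|B| = l} ->
  (0 < l)%N -> x \in U -> degree_dev G U l x <= l%:R * 'C(#|U|, l)%:R.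
Proof.
move=> hG l0 xU.
have hd : degree G U x <= 'C(#|U|, l)%:R - 'C(#|U|.-1, l)%:R.
  rewrite -(sum_mem_layer _ _ _ xU) [leRHS](big_setID (inside G U)) /=.
  rewrite (finset.setIidPr (inside_sub_layer _ U _ hG)) lerDl; exact: sumr_ge0.
have hk : #|U|%:R * ('C(#|U|, l)%:R - 'C(#|U|.-1, l)%:R)
    = l%:R * 'C(#|U|, l)%:R :> R.
  have := cardsD1 x U; rewrite xU add1n => ->; case: l l0 {hG hd} => // l _.
  rewrite /= binS natrD addrAC subrr add0r -natrD -binS -!natrM.
  by rewrite mul_bin_diag.
rewrite -hk /degree_dev; apply: (@le_trans _ _ (#|U|%:R * degree G U x)).
  by rewrite lerBlDr lerDl mulr_ge0.
by rewrite ler_wpM2l.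
Qed.

(* With [S B] the sum of the deviations over [B], the left side is
   [#|U| * \sum_B 1_G(B) S(B)]; the [S B] sum to zero, so [1_G] may be replaced
   by [1_G - 1/2], and AM-GM with [\sum_B S(B)^2 <= (C l / k) * lhs] closes. *)
Lemma sum_degree_dev_sqr G U l : {in G, forall B, #|B| = l} ->
  (0 < l)%N -> (l < #|U|)%N ->
  \sum_(x in U) degree_dev G U l x ^+ 2
  <= #|U|%:R * l%:R * 'C(#|U|, l)%:R ^+ 2 / 4.
Proof.
move=> hG l0 lU; set d := degree_dev G U l.
have d0 : \sum_(x in U) d x = 0 by exact: sum_degree_dev.
set D := \sum_(x in U) _; set C : R := 'C(#|U|, l)%:R; set k : R := #|U|%:R.
have C0 : 0 < C by rewrite ltr0n bin_gt0 ltnW.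
have k0 : 0 < k by rewrite ltr0n (leq_ltn_trans _ lU).
have lR0 : 0 < l%:R :> R by rewrite ltr0n.
pose S B := \sum_(x in B) d x.
have DE : D = k * \sum_(B in inside G U) S B.
  rewrite -sum_degree_mul mulr_sumr.
  transitivity (\sum_(x in U) (k * (degree G U x * d x)
     - l%:R * #|inside G U|%:R * d x)).
    by apply: eq_bigr => x _; rewrite expr2 {1}/d /degree_dev -/k; ring.
  by rewrite sumrB -[X in _ - X]mulr_sumr d0 mulr0 subr0.
have S2 : \sum_(B in inside (layer T l) U) S B ^+ 2 <= D * (C * l%:R / k).
  rewrite sum_layer_sqr// mulrC ler_wpM2l//.
    by apply: sumr_ge0 => x _; exact: sqr_ge0.
  rewrite ler_pdivlMr// mulrC [leRHS]mulrC /k /C.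
  case: l l0 lU {hG d d0 D C C0 lR0 S DE} => // l _.
  case: #|U| => // -[//|n] _ /=.
  rewrite binS natrD addrAC subrr add0r -!natrM ler_nat -mul_bin_diag /=.
  by rewrite leq_mul2l /= leq_bin2l.
(* The weight [C * l] in AM-GM is chosen so that, by [S2], the quadratic terms sum to at most
   [D / (2 * k)]. After multiplication by [k] this is [D / 2], which the left side absorbs. *)
have half B :
  ((B \in G)%:R - 1 / 2) * S B <= C * l%:R / 8 + S B ^+ 2 / (2 * (C * l%:R)).
  set s := C * l%:R; have s0 : 0 < s by rewrite mulr_gt0.
  have -> : s / 8 + S B ^+ 2 / (2 * s) = (s ^+ 2 / 4 + S B ^+ 2) / (2 * s).
    by field; rewrite gt_eqF.
  rewrite ler_pdivlMr; last by rewrite mulr_gt0.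
  have h1 := sqr_ge0 (s / 2 - S B); have h2 := sqr_ge0 (s / 2 + S B).
  by case: (B \in G) => /=; nra.
have main : \sum_(B in inside G U) S B
   <= C * (C * l%:R / 8) + D * (C * l%:R / k) / (2 * (C * l%:R)).
  have -> : \sum_(B in inside G U) S B =
      \sum_(B in inside (layer T l) U) ((B \in G)%:R - 1 / 2) * S B.
    under [RHS]eq_bigr do rewrite mulrBl.
    rewrite sumrB -[X in _ - X]mulr_sumr sum_layer0// mulr0 subr0.
    rewrite [LHS]big_mkcond [RHS]big_mkcond; apply: eq_bigr => B _.
    rewrite !inE; case: (boolP (B \in G)) => [/hG->|_] /=.
      by rewrite eqxx mul1r.
    by rewrite mul0r if_same.
  apply: (@le_trans _ _ (\sum_(B in inside (layer T l) U)
     (C * l%:R / 8 + S B ^+ 2 / (2 * (C * l%:R))))); first by apply: ler_sum.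
  rewrite big_split /= sumr_const card_inside_layer -mulr_suml.
  rewrite -[_ *+ 'C(_, _)]mulr_natl lerD2l ler_pM2r//.
  by rewrite invr_gt0 !mulr_gt0.
have e : D * (C * l%:R / k) / (2 * (C * l%:R)) = D / (2 * k).
  by field; rewrite !gt_eqF.
rewrite e -(ler_pM2l k0) -DE in main.
have e2 : k * (C * (C * l%:R / 8) + D / (2 * k)) = k * l%:R * C ^+ 2 / 8 + D / 2.
  by field; rewrite gt_eqF.
by rewrite e2 in main; lra.
Qed.

(** * The density martingale: removal of one point *)

Definition density G U l : R := #|inside G U|%:R / 'C(#|U|, l)%:R.

Lemma density_setD1 G U l x : x \in U -> (l < #|U|)%N ->
  density G U l - density G (U :\ x) l =
  degree_dev G U l x / ('C(#|U|, l)%:R * (#|U| - l)%:R).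
Proof.
move=> xU lU; rewrite /density /degree_dev card_inside_setD1 -/(degree G U x).
have -> : #|U :\ x| = #|U|.-1 by rewrite (cardsD1 x U) xU.
have kE := congr1 (GRing.natmul (1 : R)) (mul_bin_down #|U| l).
rewrite /= !natrM in kE.
have C0 : 'C(#|U|, l)%:R != 0 :> R by rewrite pnatr_eq0 -lt0n bin_gt0 ltnW.
have k0 : #|U|%:R != 0 :> R by rewrite pnatr_eq0 -lt0n (leq_ltn_trans _ lU).
have kl0 : (#|U| - l)%:R != 0 :> R by rewrite pnatr_eq0 -lt0n subn_gt0.
have -> : 'C(#|U|.-1, l)%:R = (#|U| - l)%:R * 'C(#|U|, l)%:R / #|U|%:R :> R.
  by rewrite -kE; field.
move: kl0; rewrite (natrB _ (ltnW lU)) => kl0.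
by field; rewrite kl0 C0 k0.
Qed.

(** The increments [z] sum to zero, have mean square controlled by [sum_degree_dev_sqr], and are at
    most [1 / 2] by the condition on [lam]. Summing [expR_le_quadratic] and applying
    [1 + v <= expR v] gives the bound. *)
Lemma sum_expR_density_setD1 G U l (lam : R) :
  {in G, forall B, #|B| = l} -> (0 < l)%N -> (l < #|U|)%N ->
  0 <= lam -> lam * l%:R <= (#|U| - l)%:R / 2 ->
  \sum_(x in U) expR (- lam * density G (U :\ x) l) <=
  #|U|%:R * expR (- lam * density G U l
                  + lam ^+ 2 * (l%:R / (2 * (#|U| - l)%:R ^+ 2))).
Proof.
move=> hG l0 lU lam0 hlam.
set C : R := 'C(#|U|, l)%:R; set k : R := #|U|%:R; set j : R := (#|U| - l)%:R.
have C0 : 0 < C by rewrite ltr0n bin_gt0 ltnW.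
have k0 : 0 < k by rewrite ltr0n (leq_ltn_trans _ lU).
have j0 : 0 < j by rewrite ltr0n subn_gt0.
pose z x := lam * (degree_dev G U l x / (C * j)).
have zE x : x \in U -> expR (- lam * density G (U :\ x) l) =
    expR (- lam * density G U l) * expR (z x).
  by move=> xU; rewrite -expRD /z -density_setD1//; congr expR; ring.
rewrite (eq_bigr _ zE) -mulr_sumr expRD (mulrCA k) ler_pM2l ?expR_gt0//.
have z0 : \sum_(x in U) z x = 0.
  by rewrite -mulr_sumr -mulr_suml sum_degree_dev// mul0r mulr0.
have z2 : \sum_(x in U) z x ^+ 2 <= lam ^+ 2 * (k * l%:R / (4 * j ^+ 2)).
  have -> : \sum_(x in U) z x ^+ 2 =
      lam ^+ 2 / (C * j) ^+ 2 * \sum_(x in U) degree_dev G U l x ^+ 2.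
    rewrite mulr_sumr; apply: eq_bigr => x _; rewrite /z.
    by field; rewrite !gt_eqF.
  have -> : lam ^+ 2 * (k * l%:R / (4 * j ^+ 2)) =
      lam ^+ 2 / (C * j) ^+ 2 * (k * l%:R * C ^+ 2 / 4).
    by field; rewrite !gt_eqF.
  rewrite ler_wpM2l ?sum_degree_dev_sqr//.
  by rewrite divr_ge0 ?sqr_ge0.
have zle x : x \in U -> z x <= 1 / 2.
  move=> xU; rewrite /z mulrA ler_pdivrMr; last exact: mulr_gt0.
  apply: (@le_trans _ _ (lam * (l%:R * C))).
    by rewrite ler_wpM2l// degree_dev_le.
  rewrite mulrA (le_trans (ler_wpM2r (ltW C0) hlam))//.
  by rewrite -/j; lra.
apply: (@le_trans _ _ (\sum_(x in U) (1 + z x + 2 * z x ^+ 2))).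
  by apply: ler_sum => x /zle; exact: expR_le_quadratic.
rewrite 2!big_split /= z0 sumr_const -mulr_sumr addr0 -/k.
apply: (@le_trans _ _ (k * (1 + lam ^+ 2 * (l%:R / (2 * j ^+ 2))))).
  have -> : k * (1 + lam ^+ 2 * (l%:R / (2 * j ^+ 2))) =
     k + 2 * (lam ^+ 2 * (k * l%:R / (4 * j ^+ 2))).
    by field; rewrite gt_eqF.
  by rewrite lerD2l ler_pM2l.
by rewrite ler_pM2l// expR_ge1Dx.
Qed.

(** * Removal of several points *)

(** Double counting of pairs [x \in H], with [x] read as the first point removed. *)
Lemma sum_removals (F : {set T} -> R) U r :
  r.+1%:R * \sum_(H in inside (layer T r.+1) U) F (U :\: H) =
  \sum_(x in U) \sum_(H in inside (layer T r) (U :\ x)) F (U :\ x :\: H).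
Proof.
rewrite mulr_sumr.
transitivity (\sum_(H in inside (layer T r.+1) U)
   \sum_(x in U | x \in H) F (U :\: H)).
  apply: eq_bigr => H; rewrite !inE => /andP[/eqP cH HU].
  rewrite (eq_bigl (mem H)); last first.
    move=> x /=; case xH: (x \in H); last by rewrite andbF.
    by rewrite (fintype.subsetP HU).
  by rewrite sumr_const cH mulr_natl.
rewrite (exchange_big_dep (mem U)) /=; last by move=> H x _ /andP[].
apply: eq_bigr => x xU.
rewrite (reindex_onto (fun H => x |: H) (fun H => H :\ x)) /=; last first.
  by move=> H /andP[_ /andP[_ xH]]; rewrite finset.setD1K.
apply: eq_big => [H|H _]; last by rewrite finset.setDDl.
rewrite !inE eqxx /= xU finset.subUset finset.sub1set xU /= subsetD1.
case: (boolP (x \in H)) => xH /=.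
  rewrite !andbF; apply/andP => -[_ /eqP e].
  by move: (setD11 x (x |: H)); rewrite e xH.
by rewrite cardsU1 xH setU1K// eqxx !andbT.
Qed.

(** Induction on [r], removing one point and then [r] points from the rest. The final size is the
    same for both, so the condition on [lam], stated at that smallest size, passes to the induction
    hypothesis; the step costs telescope into a difference of reciprocals. *)
Lemma sum_expR_density_setD G U l r (lam : R) :
  {in G, forall B, #|B| = l} -> (0 < l)%N -> (l + r < #|U|)%N ->
  0 <= lam -> lam * l%:R <= (#|U| - r - l)%:R / 2 ->
  \sum_(H in inside (layer T r) U) expR (- lam * density G (U :\: H) l) <=
  'C(#|U|, r)%:R * expR (- lam * density G U l
     + lam ^+ 2 * (l%:R / 2 * ((#|U| - r - l)%:R^-1 - (#|U| - l)%:R^-1))).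
Proof.
move=> hG l0 + lam0.
elim: r U => [|r IH] U hr hlam.
  rewrite bin0 subn0 subrr !mulr0 addr0 mul1r (big_pred1 finset.set0) ?finset.setD0//.
  move=> H; rewrite !inE cards_eq0 /=.
  by case: eqP => [->|//]; rewrite finset.sub0set.
have lU : (l < #|U|)%N by lia.
rewrite -(ler_pM2l (ltr0Sn R r)).
rewrite (sum_removals (fun V => expR (- lam * density G V l))).
set j : R := (#|U| - l)%:R; set u : R := (#|U| - r.+1 - l)%:R.
have j1 : (#|U| - l)%:R = 1 + (#|U|.-1 - l)%:R :> R.
  by rewrite -[1]/(1%:R) -natrD; congr _%:R; lia.
have j0 : 0 < (#|U|.-1 - l)%:R :> R by rewrite ltr0n; lia.
pose c := lam ^+ 2 * (l%:R / 2 * (u^-1 - (#|U|.-1 - l)%:R^-1)).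
apply: (@le_trans _ _ (\sum_(x in U) 'C(#|U|.-1, r)%:R *
    expR (- lam * density G (U :\ x) l + c))).
  apply: ler_sum => x xU.
  have cUx : #|U :\ x| = #|U|.-1 by rewrite (cardsD1 x U) xU.
  have e : (#|U|.-1 - r - l = #|U| - r.+1 - l)%N by lia.
  rewrite /c /u -e -cUx; apply: IH; rewrite cUx ?e//; lia.
have -> : \sum_(x in U) 'C(#|U|.-1, r)%:R *
    expR (- lam * density G (U :\ x) l + c) = 'C(#|U|.-1, r)%:R * expR c *
    \sum_(x in U) expR (- lam * density G (U :\ x) l).
  by rewrite mulr_sumr; apply: eq_bigr => x _; rewrite expRD; ring.
have hl1 : lam * l%:R <= (#|U| - l)%:R / 2.
  by apply: (le_trans hlam); rewrite ler_pM2r// ler_nat; lia.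
have step := sum_expR_density_setD1 G U l lam hG l0 lU lam0 hl1.
apply: (@le_trans _ _ ('C(#|U|.-1, r)%:R * expR c * (#|U|%:R *
   expR (- lam * density G U l + lam ^+ 2 * (l%:R / (2 * j ^+ 2)))))).
  by rewrite ler_wpM2l// mulr_ge0// expR_ge0.
have -> : r.+1%:R * ('C(#|U|, r.+1)%:R *
   expR (- lam * density G U l + lam ^+ 2 * (l%:R / 2 * (u^-1 - j^-1)))) =
   'C(#|U|.-1, r)%:R * #|U|%:R *
   expR (- lam * density G U l + lam ^+ 2 * (l%:R / 2 * (u^-1 - j^-1))) :> R.
  by rewrite mulrA -!natrM -mul_bin_diag mulnC.
rewrite -mulrA (mulrCA (expR c)) -expRD mulrA ler_wpM2l//.
rewrite ler_expR addrCA lerD2l /c -mulrDr ler_wpM2l ?sqr_ge0//.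
(* telescoping: [1/j^2 <= 1/(j-1) - 1/j] *)
have key : (j ^+ 2)^-1 <= (#|U|.-1 - l)%:R^-1 - j^-1.
  rewrite /j j1; set i : R := (#|U|.-1 - l)%:R in j0 *.
  have -> : i^-1 - (1 + i)^-1 = (i * (1 + i))^-1.
    by field; rewrite !gt_eqF//; lra.
  by rewrite lef_pV2 ?posrE; nra.
have -> : l%:R / (2 * j ^+ 2) = l%:R / 2 * (j ^+ 2)^-1.
  by rewrite invfM mulrA.
rewrite -mulrDr ler_wpM2l ?divr_ge0//; lra.
Qed.

(** * Markov's inequality and the tail bound *)

Lemma density_lower_tail G U l r t (eps : R) :
  {in G, forall B, #|B| = l} -> (0 < l)%N -> (1 < t)%N ->
  (t * l + r <= #|U|)%N -> 0 <= eps <= 1 ->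
  #|[set H in inside (layer T r) U |
      density G (U :\: H) l < density G U l - eps]|%:R <=
  'C(#|U|, r)%:R * expR (- (3 / 8 * (t.-1%:R * eps ^+ 2))).
Proof.
move=> hG l0 t1 htl /andP[eps0 eps1].
(* This [lam] is half the minimizer [n * eps] of [lam ^+ 2 / (2 * n) - lam * eps]; with [eps <= 1]
   the halving ensures [lam * l <= n * l / 2], as the step bound requires. The exponent becomes
   [n * eps ^+ 2 * (1 / 8 - 1 / 2)]. *)
set n : R := t.-1%:R; pose lam := n * eps / 2.
have n0 : 0 < n by rewrite ltr0n; lia.
have lR0 : 0 < l%:R :> R by rewrite ltr0n.
have lam0 : 0 <= lam by rewrite divr_ge0// mulr_ge0// ltW.
have hn : (t.-1 * l <= #|U| - r - l)%N by case: t t1 htl {n lam n0 lam0} => // t; nia.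
have nl : n * l%:R <= (#|U| - r - l)%:R by rewrite -natrM ler_nat.
have u0 : 0 < (#|U| - r - l)%:R :> R by apply: lt_le_trans nl; exact: mulr_gt0.
have lr : (l + r < #|U|)%N by move: u0; rewrite ltr0n; lia.
have hlam : lam * l%:R <= (#|U| - r - l)%:R / 2.
  rewrite /lam; apply: le_trans (_ : n * l%:R / 2 <= _); last by lra.
  by have := ler_wpM2l (mulr_ge0 (ltW n0) (ltW lR0)) eps1; lra.
have := sum_expR_density_setD G U l r lam hG l0 lr lam0 hlam.
set bad := [set H in _ | _]; set d := density G U l => hsum.
have markov : #|bad|%:R * expR (- lam * (d - eps)) <=
    \sum_(H in inside (layer T r) U) expR (- lam * density G (U :\: H) l).
  rewrite mulr_natl -sumr_const [leRHS](big_setID bad) /=.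
  have -> : inside (layer T r) U :&: bad = bad.
    by apply/finset.setIidPr/fintype.subsetP => H; rewrite inE => /andP[].
  apply: ler_wpDr; first by apply: sumr_ge0 => *; exact: expR_ge0.
  apply: ler_sum => H; rewrite inE => /andP[_ Hd].
  by rewrite ler_expR !mulNr lerN2 ler_wpM2l// ltW.
have := le_trans markov hsum; rewrite -ler_pdivlMr ?expR_gt0// => h.
apply: (le_trans h); rewrite -[leLHS]mulrA -expRN -expRD ler_wpM2l// ler_expR.
have : lam ^+ 2 * (l%:R / 2 * ((#|U| - r - l)%:R^-1 - (#|U| - l)%:R^-1)) <=
    n * eps ^+ 2 / 8.
  apply: (@le_trans _ _ (lam ^+ 2 * (1 / (2 * n)))).
    rewrite ler_wpM2l ?sqr_ge0//.
    apply: (@le_trans _ _ (l%:R / 2 * (n * l%:R)^-1)).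
      rewrite ler_wpM2l ?divr_ge0//.
      rewrite (@le_trans _ _ (#|U| - r - l)%:R^-1)//.
        by rewrite gerBl invr_ge0.
      by rewrite lef_pV2 ?posrE// mulr_gt0.
    by rewrite [leLHS](_ : _ = 1 / (2 * n))//; field; rewrite !gt_eqF.
  by rewrite [leLHS](_ : _ = n * eps ^+ 2 / 8)// /lam; field; rewrite gt_eqF.
by rewrite /lam; lra.
Qed.

End SliceMoments.

(** * Specialization to a uniform [l']-subset of ['I_m] *)

Theorem mainTheorem6 (R : realType) (m l l' t : nat) (a : R)
  (hl : (0 < l)%N) (hl' : (0 < l')%N) (ht : (0 < t)%N)
  (hmt : (t * l + l' <= m)%N) (ha : 0 < a)
  (G : {set {set 'I_m}}) (hG : forall G0, G0 \in G -> #|G0| = l) :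
  let eps : R := (2 * a + Num.sqrt (8 * ln 2)) / Num.sqrt (t%:R) in
  let alpha : R := #|G|%:R / ('C(m, l))%:R in
  unif_prob R l'
    (fun H => #|avoid G H|%:R < (alpha - eps) * ('C(m - l', l))%:R)
  < 2 * expR (- (a ^+ 2) / 2).
Proof.
cbv zeta.
set eps : R := (_ / Num.sqrt t%:R); set alpha : R := (_ / 'C(m, l)%:R).
rewrite /unif_prob.
set bad := [set H | _].
have tR0 : 0 < t%:R :> R by rewrite ltr0n.
have hml' : (l' <= m)%N by apply: leq_trans hmt; exact: leq_addl.
have hml : (l <= m - l')%N by case: t ht hmt {eps bad tR0} => // t; nia.
have Cl' : 0 < 'C(m, l')%:R :> R by rewrite ltr0n bin_gt0.
have Cl : 0 < 'C(m - l', l)%:R :> R by rewrite ltr0n bin_gt0.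
have cT : #|[set: 'I_m]| = m by rewrite cardsT card_ord.
have inT : inside G [set: 'I_m] = G.
  by apply/finset.setP => B; rewrite inE finset.subsetT andbT.
have alphaE : alpha = density R 'I_m G [set: 'I_m] l.
  by rewrite /density inT cT.
have alpha1 : alpha <= 1.
  rewrite ler_pdivrMr ?ltr0n ?bin_gt0; last by rewrite (leq_trans hml)// leq_subr.
  have := subset_leq_card (inside_sub_layer _ G [set: 'I_m] _ hG).
  by rewrite inT card_inside_layer cT mul1r ler_nat.
have ln2 : 1 <= 8 * ln 2 :> R.
  have : 1 / 8 <= ln 2 :> R.
    rewrite -ler_expR lnK ?posrE// (le_trans (expR_le_quadratic _ _ _))//; lra.
  by lra.
have s1 : 1 <= Num.sqrt (8 * ln 2) :> R.
  by rewrite -[leLHS]sqrtr1 ler_sqrt; lra.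
have eps0 : 0 <= eps by rewrite divr_ge0 ?sqrtr_ge0//; lra.
(* If [eps >= 1], then [alpha - eps <= 0] and no cardinality lies below the threshold. Otherwise
   [t >= 2], since [t = 1] would give [eps = 2 * a + Num.sqrt (8 * ln 2) > 1]. *)
have [eps1|eps1] := leP 1 eps.
  suff -> : bad = finset.set0 by rewrite cards0 mul0r mulr_gt0 ?expR_gt0.
  apply/finset.setP => H; rewrite !inE; apply/negbTE; rewrite negb_and -leNgt.
  apply/orP; right; apply: (@le_trans _ _ 0) => //.
  by rewrite pmulr_lle0//; lra.
have t1 : (1 < t)%N.
  case: t ht {hmt bad tR0 eps0} @eps eps1 => // -[|//] _ eps.
  by rewrite /eps sqrtr1 divr1; lra.
have badE : bad = [set H in inside (layer 'I_m l') [set: 'I_m] |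
   density R 'I_m G ([set: 'I_m] :\: H) l < density R 'I_m G [set: 'I_m] l - eps].
  apply/finset.setP => H; rewrite !inE finset.subsetT andbT.
  case: eqP => //= cH; rewrite -alphaE finset.setTD /density.
  have -> : #|~: H| = (m - l')%N by rewrite cardsCs card_ord finset.setCK cH.
  rewrite ltr_pdivrMr//; congr (_%:R < _); apply: eq_card => B.
  by rewrite !inE finset.disjoints_subset.
have htU : (t * l + l' <= #|[set: 'I_m]|)%N by rewrite cT.
have eps01 : 0 <= eps <= 1 by rewrite eps0 ltW.
have := density_lower_tail R 'I_m G [set: 'I_m] l l' t eps hG hl t1 htU eps01.
rewrite -badE cT => hbad.
rewrite ltr_pdivrMr//; apply: (le_lt_trans hbad).
rewrite mulrC ltr_pM2r//.
have te : t%:R * eps ^+ 2 = (2 * a + Num.sqrt (8 * ln 2)) ^+ 2.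
  by rewrite /eps expr_div_n sqr_sqrtr ?ler0n// mulrC divfK// gt_eqF.
have t2 : t%:R / 2 <= t.-1%:R :> R.
  by rewrite ler_pdivrMr// -natrM ler_nat; lia.
have h1 : t%:R / 2 * eps ^+ 2 <= t.-1%:R * eps ^+ 2 by rewrite ler_wpM2r ?sqr_ge0.
(* By [t - 1 >= t / 2] the exponent is at least [3 / 16 * (2 * a + s) ^+ 2 >= 3 / 4 * a ^+ 2] in
   absolute value, which exceeds [a ^+ 2 / 2]. The factor 2 then gives strictness. *)
apply: (@le_lt_trans _ _ (expR (- a ^+ 2 / 2))).
  rewrite ler_expR; set s := Num.sqrt _ in s1 te; nra.
by rewrite ltr_pMl ?expR_gt0//; lra.
Qed.
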